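(* Let $q$ be an indefinite real quadratic form on $\mathbb{R}^n$, and let $r$ be a homogeneous real polynomial in $n$ variables (of arbitrary degree, not necessarily a quadratic form) such that for all $\mathbf{x} \in \mathbb{R}^n$, $q(\mathbf{x}) = 0 \implies r(\mathbf{x}) = 0$. Then $q$ is a factor of $r$; that is, $r(\mathbf{x}) = q(\mathbf{x})s(\mathbf{x})$ for some real polynomial $s(\mathbf{x})$ in $n$ variables.
   Context: A function $q : \mathbb{R}^n \to \mathbb{R}$ is a real quadratic form if there is a symmetric bilinear function $\tilde{q} : \mathbb{R}^n \times \mathbb{R}^n \to \mathbb{R}$ such that $q(\mathbf{x}) = \tilde{q}(\mathbf{x}, \mathbf{x})$ for all $\mathbf{x}$; it is regarded as a real polynomial in $n$ variables. A real quadratic form is indefinite if it takes both positive and negative values. A polynomial in $n$ variables is homogeneous of degree $d$ if each of its terms has the same degree $d$. *)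

(* Defs.v *)
From HB Require Import structures.
From mathcomp Require Import all_boot all_order all_algebra.
From mathcomp Require Import reals.
From mathcomp Require Import mpoly.

Set Implicit Arguments.
Unset Strict Implicit.
Unset Printing Implicit Defensive.

Local Open Scope ring_scope.

(* [meval] takes its point as a function on ['I_n], hence the [x 0]. *)
Definition peval (R : realType) (n : nat) (p : {mpoly R[n]}) (x : 'rV[R]_n) : R :=
  p.@[x 0].

Definition is_quadratic_form (R : realType) (n : nat) (q : 'rV[R]_n -> R) : Prop :=
  exists B : {symmetric 'rV[R]_n}, forall x, q x = B x x.

Definition indefinite (R : realType) (n : nat) (q : 'rV[R]_n -> R) : Prop :=
  (exists x, 0 < q x) /\ (exists y, q y < 0).

(* Main.v *)
(** Pick [v] with [q v > 0], so that [q (x + T v)], as a polynomial in [T] over the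
    polynomials in [x], is quadratic with an invertible constant as leading
    coefficient.  Divide [r (x + T v)] by it; the remainder is [A x * T + C x].
    For [x] in the nonempty open set [q x < 0] the quadratic has two distinct real
    roots, at which [r] vanishes too, so [A x = C x = 0].  Hence [A = C = 0], and
    setting [T = 0] in the quotient gives the cofactor. *)

Require Import Defs.
From HB Require Import structures.
From mathcomp Require Import all_boot all_order all_algebra.
From mathcomp Require Import reals.
From mathcomp Require Import polyrcf.
From mathcomp Require Import ring lra.
From mathcomp Require Import mpoly.
Import Order.TTheory GRing.Theory Num.Theory.

Set Implicit Arguments.
Unset Strict Implicit.
Unset Printing Implicit Defensive.

Local Open Scope ring_scope.

(** Constants and variables generate the polynomial ring. Each identity between substitutions below
    is thus checked on generators only. *)
Lemma mpoly_rmorph_ext (n : nat) (R : nzRingType) (S : comNzRingType)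
    (f g : {rmorphism {mpoly R[n]} -> S}) :
  (forall c, f c%:MP = g c%:MP) -> (forall i, f 'X_i = g 'X_i) -> f =1 g.
Proof.
move=> fgC fgX; elim/mpolyind => [|c m p _ _ IH]; first by rewrite !rmorph0.
rewrite !rmorphD IH -mul_mpolyC !rmorphM fgC mpolyXE_id !rmorph_prod.
by congr (_ * _ + _); apply: eq_bigr => i _; rewrite !rmorphXn /= fgX.
Qed.

(* The substitution [p(x) |-> p(x + T v)], the new variable [T] being the outer ['X]. *)
Definition translate (n : nat) (R : comNzRingType) (v : 'I_n -> R)
    : {mpoly R[n]} -> {poly {mpoly R[n]}} :=
  mmap (polyC \o mpolyC n (R:=R)) (fun i => ('X_i)%:P + (v i)%:MP%:P * 'X).

HB.instance Definition _ (n : nat) (R : comNzRingType) (v : 'I_n -> R) :=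
  GRing.RMorphism.on (translate v).

Lemma translateC (n : nat) (R : comNzRingType) (v : 'I_n -> R) c :
  translate v c%:MP = c%:MP%:P.
Proof. by rewrite /translate mmapC. Qed.

Lemma translateX (n : nat) (R : comNzRingType) (v : 'I_n -> R) i :
  translate v 'X_i = ('X_i)%:P + (v i)%:MP%:P * 'X.
Proof. by rewrite /translate mmapX mmap1U. Qed.

Lemma translate_eval (n : nat) (R : comNzRingType) (v x : 'I_n -> R) t
    (p : {mpoly R[n]}) :
  (map_poly (meval x) (translate v p)).[t] = p.@[fun i => x i + t * v i].
Proof.
pose f : {rmorphism {mpoly R[n]} -> R} :=
  horner_eval t \o map_poly (meval x) \o translate v.
pose g : {rmorphism {mpoly R[n]} -> R} := meval (fun i => x i + t * v i).
apply: (@mpoly_rmorph_ext _ _ _ f g) => [c|i]; rewrite /f /g /= /horner_eval.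
  by rewrite translateC map_polyC /= hornerC !mevalC.
rewrite translateX rmorphD rmorphM /= !map_polyC /= map_polyX !hornerE.
by rewrite !mevalXU !mevalC mulrC.
Qed.

Lemma translate_at0 (n : nat) (R : comNzRingType) (v : 'I_n -> R)
    (p : {mpoly R[n]}) : (translate v p).[0] = p.
Proof.
pose f : {rmorphism {mpoly R[n]} -> {mpoly R[n]}} :=
  horner_eval 0 \o translate v.
apply: (@mpoly_rmorph_ext _ _ _ f idfun) => [c|i]; rewrite /f /= /horner_eval.
  by rewrite translateC hornerC.
by rewrite translateX !hornerE.
Qed.

Lemma poly_eq0_of_inj_roots (R : idomainType) (p : {poly R}) (f : nat -> R) :
  injective f -> (forall k, p.[f k] = 0) -> p = 0.
Proof.
move=> f_inj pf; apply/eqP/negPn/negP => p0.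
have := @max_poly_roots _ p [seq f k | k <- iota 0 (size p)] p0.
rewrite size_map size_iota ltnn map_inj_uniq // iota_uniq => H.
suff: false by []. apply: H => //.
by apply/allP => _ /mapP[k _ ->]; apply/rootP.
Qed.

(** Induction on the number of variables. With the other variables fixed at [x], the polynomial in
    the last one vanishes at every natural number, and these are distinct in a [numDomainType]; so
    each of its coefficients vanishes at every [x]. *)
Lemma mpoly_eval_eq0 (R : numDomainType) (n : nat) (p : {mpoly R[n]}) :
  (forall x, p.@[x] = 0) -> p = 0.
Proof.
elim: n p => [|n IH] p p0.
  by have := p0 (fun=> 0); rewrite [p]nvar0_mpolyC mevalC => ->; rewrite mpolyC0.
(* [split_last] makes the last variable the outer ['X]; [widen] followed by evaluation at
   ['X_ord_max] undoes this, so it suffices to show [split_last p = 0]. *)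
pose xlast i : {poly {mpoly R[n]}} :=
  if unlift ord_max i is Some j then ('X_j)%:P else 'X.
pose split_last : {rmorphism {mpoly R[n.+1]} -> {poly {mpoly R[n]}}} :=
  mmap (polyC \o mpolyC n (R:=R)) xlast.
pose widen : {rmorphism {mpoly R[n]} -> {mpoly R[n.+1]}} :=
  mmap (mpolyC n.+1 (R:=R)) (fun j => 'X_(lift ord_max j)).
have splitK : (map_poly widen (split_last p)).['X_ord_max] = p.
  pose f : {rmorphism {mpoly R[n.+1]} -> {mpoly R[n.+1]}} :=
    horner_eval 'X_ord_max \o map_poly widen \o split_last.
  apply: (@mpoly_rmorph_ext _ _ _ f idfun) => [c|i]; rewrite /f /= /horner_eval.
    by rewrite mmapC /= map_polyC /= mmapC hornerC.
  rewrite mmapX mmap1U /xlast; case: unliftP => [j|] ->.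
    by rewrite map_polyC /= mmapX mmap1U hornerC.
  by rewrite map_polyX hornerX.
have split_eval x t : (map_poly (meval x) (split_last p)).[t] =
    p.@[fun i => if unlift ord_max i is Some j then x j else t].
  pose f : {rmorphism {mpoly R[n.+1]} -> R} :=
    horner_eval t \o map_poly (meval x) \o split_last.
  pose g : {rmorphism {mpoly R[n.+1]} -> R} :=
    meval (fun i => if unlift ord_max i is Some j then x j else t).
  apply: (@mpoly_rmorph_ext _ _ _ f g) => [c|i]; rewrite /f /g /= /horner_eval.
    by rewrite mmapC map_polyC /= hornerC !mevalC.
  rewrite mmapX mmap1U mevalXU /xlast; case: unliftP => [j|] _.
    by rewrite map_polyC /= hornerC mevalXU.
  by rewrite map_polyX hornerX.
rewrite -splitK; suff -> : split_last p = 0 by rewrite rmorph0 horner0.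
apply/polyP => k; rewrite coef0; apply: IH => x.
rewrite -[LHS]coef_map /=.
rewrite (@poly_eq0_of_inj_roots _ (map_poly _ _) (fun m => m%:R)) ?coef0 //.
  by move=> a b /eqP; rewrite eqr_nat => /eqP.
by move=> m; rewrite split_eval p0.
Qed.

(** Restrict to the line from [y] to [x]. By continuity [p] stays negative near [y], so [a] has
    infinitely many zeros on the line, hence vanishes on all of it, in particular at [x]. *)
Lemma mpoly_eq0_on_neg (R : rcfType) (n : nat) (p a : {mpoly R[n]}) y :
  p.@[y] < 0 -> (forall x, p.@[x] < 0 -> a.@[x] = 0) -> a = 0.
Proof.
move=> py a0; apply: mpoly_eval_eq0 => x.
pose w i := x i - y i.
pose line c := map_poly (meval y) (translate w c).
have line0 c : (line c).[0] = c.@[y].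
  by rewrite translate_eval; apply: meval_eq => i; rewrite mul0r addr0.
have [|d d0 near0] := @poly_cont R 0 (line p) (- p.@[y]); first by rewrite oppr_gt0.
have -> : a.@[x] = (line a).[1].
  by rewrite translate_eval; apply: meval_eq => i; rewrite mul1r /w addrC subrK.
(* The shift to [k.+2] keeps every parameter strictly below [d], the radius given by continuity. *)
rewrite (@poly_eq0_of_inj_roots _ (line a) (fun k => d / k.+2%:R)) ?horner0 //.
  move=> i j /(mulfI (lt0r_neq0 d0)) /invr_inj /eqP.
  by rewrite eqr_nat => /eqP [].
move=> k; rewrite translate_eval; apply: a0; rewrite -translate_eval.
have := near0 (d / k.+2%:R); rewrite subr0 line0 => H.
have : `|d / k.+2%:R| < d.
  rewrite ger0_norm ?divr_ge0 ?ler0n ?ltW //.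
  by rewrite ltr_pdivrMr ?ltr0n // ltr_pMr // ltr1n.
by move/H; rewrite ltr_norml => /andP[_]; rewrite /line; lra.
Qed.

(** The case where the leading coefficient in [T] is 1. The coefficients are themselves polynomials,
    so Euclidean division relies on the divisor being monic. *)
Lemma dvd_of_vanish (R : rcfType) (n : nat) (v y : 'I_n -> R)
    (p b r : {mpoly R[n]}) :
  translate v p = p%:P + b%:P * 'X + 'X^2 -> p.@[y] < 0 ->
  (forall x, p.@[x] = 0 -> r.@[x] = 0) -> exists s, r = p * s.
Proof.
move=> tp py pr.
have szl : (size (p%:P + b%:P * 'X)%R < 3)%N.
  by rewrite addrC size_MXaddC; case: ifP => // _; rewrite !ltnS size_polyC leq_b1.
have p_monic : translate v p \is monic.
  by rewrite monicE tp addrC lead_coefDl ?size_polyXn // lead_coefXn.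
have tp_sz : size (translate v p) = 3%N.
  by rewrite tp addrC size_polyDl size_polyXn.
have := Pdiv.RingMonic.rdivp_eq p_monic (translate v r).
have := Pdiv.Ring.ltn_rmodp (translate v r) (translate v p).
rewrite monic_neq0 // tp_sz.
move: (Pdiv.Ring.rdivp _ _) (Pdiv.Ring.rmodp _ _) => s m sz_m r_eq.
suff m0 : m = 0.
  exists s.[0]; rewrite -[LHS](translate_at0 v) r_eq m0 addr0 hornerM.
  by rewrite translate_at0 mulrC.
have m_eq : m = (m`_0)%:P + (m`_1)%:P * 'X.
  apply/polyP => -[|[|k]]; rewrite coefD coefC coefMX coefC /= ?addr0 ?add0r //.
  by rewrite nth_default // -ltnS (leq_trans sz_m).
have m_van x : p.@[x] < 0 -> (m`_0).@[x] = 0 /\ (m`_1).@[x] = 0.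
  move=> px; set bx := b.@[x].
  (* The discriminant of the quadratic in [T] at [x] is positive because its constant term [p.@[x]]
     is negative. *)
  have disc0 : 0 < bx ^+ 2 - 4 * p.@[x] by nra.
  set d := Num.sqrt (bx ^+ 2 - 4 * p.@[x]).
  have d0 : 0 < d by rewrite sqrtr_gt0.
  have d2 : d ^+ 2 = bx ^+ 2 - 4 * p.@[x] by rewrite sqr_sqrtr // ltW.
  (* A root [t] makes [p] vanish at [x + t v], hence [r] too, and the division identity leaves only
     the remainder. *)
  have root t : p.@[x] + bx * t + t ^+ 2 = 0 -> (m`_0).@[x] + (m`_1).@[x] * t = 0.
    move=> pt.
    have ev : (map_poly (meval x) (translate v p)).[t] = 0.
      rewrite tp !rmorphD rmorphM /= !map_polyC map_polyX map_polyXn /= !hornerE.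
      exact: pt.
    have := pr _ (etrans (esym (translate_eval _ _ _ _)) ev).
    rewrite -translate_eval r_eq rmorphD rmorphM /= !hornerE ev mulr0 add0r m_eq.
    by rewrite rmorphD rmorphM /= !map_polyC map_polyX /= !hornerE -m_eq.
  have r1 := root ((- bx + d) / 2).
  have r2 := root ((- bx - d) / 2).
  have {}r1 : (m`_0).@[x] + (m`_1).@[x] * ((- bx + d) / 2) = 0 by apply: r1; nra.
  have {}r2 : (m`_0).@[x] + (m`_1).@[x] * ((- bx - d) / 2) = 0 by apply: r2; nra.
  have m1 : (m`_1).@[x] = 0.
    (* The two roots differ by [d], so this is the difference of [r1] and [r2]. *)
    have : (m`_1).@[x] * d = 0 by lra.
    by move/eqP; rewrite mulf_eq0 (gt_eqF d0) orbF => /eqP.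
  by split=> //; move: r1; rewrite m1 mul0r addr0.
have m0 : m`_0 = 0 by apply: mpoly_eq0_on_neg py _ => x /m_van[].
have m1 : m`_1 = 0 by apply: mpoly_eq0_on_neg py _ => x /m_van[].
by rewrite m_eq m0 m1 mul0r addr0.
Qed.

Definition quad_mpoly (R : comNzRingType) (n : nat) (c : 'I_n -> 'I_n -> R)
    : {mpoly R[n]} :=
  \sum_i \sum_j c i j *: ('X_i * 'X_j).

Lemma quad_mpoly_eval (R : comNzRingType) (n : nat) (c : 'I_n -> 'I_n -> R) x :
  (quad_mpoly c).@[x] = \sum_i \sum_j c i j * (x i * x j).
Proof.
rewrite rmorph_sum /=; apply: eq_bigr => i _; rewrite rmorph_sum /=.
by apply: eq_bigr => j _; rewrite mevalZ mevalM !mevalXU.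
Qed.

Lemma translate_quad (R : comNzRingType) (n : nat) (c : 'I_n -> 'I_n -> R) v :
  exists b : {mpoly R[n]}, translate v (quad_mpoly c) =
    (quad_mpoly c)%:P + b%:P * 'X + (quad_mpoly c).@[v]%:MP%:P * 'X^2.
Proof.
(* The coefficient of [T] in [(x_i + T v_i) (x_j + T v_j)], weighted by [c i j]. *)
exists (\sum_i \sum_j c i j *: ((v j)%:MP * 'X_i + (v i)%:MP * 'X_j)).
rewrite quad_mpoly_eval /quad_mpoly !rmorph_sum /= !mulr_suml -!big_split /=.
apply: eq_bigr => i _; rewrite !rmorph_sum /= !mulr_suml -!big_split /=.
apply: eq_bigr => j _; rewrite -!mul_mpolyC !rmorphM /= !rmorphD !rmorphM /=.
by rewrite translateC !translateX; ring.
Qed.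

Lemma symmetric_form_sum (R : comNzRingType) (n : nat)
    (B : {symmetric 'rV[R]_n}) (x : 'rV[R]_n) :
  B x x = \sum_i \sum_j
    B (delta_mx 0 i) (delta_mx 0 j) * (x 0 i * x 0 j).
Proof.
rewrite {1 2}(row_sum_delta x) linear_sumlz.
apply: eq_bigr => i _; rewrite linear_sumr /=; apply: eq_bigr => j _.
by rewrite linearZl_LR linearZr_LR /= mulrA mulrC.
Qed.

Theorem mainTheorem2 (R : realType) (n : nat) (q : 'rV[R]_n -> R)
    (q_quad : is_quadratic_form q) (q_indef : indefinite q)
    (d : nat) (r : {mpoly R[n]}) (r_homog : r \is d.-homog)
    (r_vanish : forall x : 'rV[R]_n, q x = 0 -> peval r x = 0) :
  exists p s : {mpoly R[n]}, (forall x : 'rV[R]_n, q x = peval p x) /\ r = p * s.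
Proof.
case: q_quad => B qB; case: q_indef => -[v qv] [y qy].
pose p := quad_mpoly (fun i j => B (delta_mx 0 i) (delta_mx 0 j)).
have qp x : q x = peval p x by rewrite qB symmetric_form_sum -quad_mpoly_eval.
have [b pb] := translate_quad (fun i j => B (delta_mx 0 i) (delta_mx 0 j)) (v 0).
have a0 : p.@[v 0] != 0 by have := qv; rewrite qp => /lt0r_neq0.
set a := p.@[v 0] in a0 pb.
(* Dividing by [a], the value of [q] at [v], makes the quadratic in [T] monic; as [a] is positive,
   the sign at [y] and the zeros are unchanged. *)
have [|||s rs] := @dvd_of_vanish R n (v 0) (y 0) (a^-1 *: p) (a^-1 *: b) r.
- have a1 : (a^-1)%:MP%:P * a%:MP%:P = 1 :> {poly {mpoly R[n]}}.
    by rewrite -polyCM -mpolyCM mulVf.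
  rewrite -[a^-1 *: p]mul_mpolyC -[a^-1 *: b]mul_mpolyC.
  rewrite rmorphM /= translateC pb [(_ * p)%:P]polyCM [(_ * b)%:P]polyCM.
  by rewrite 2!mulrDr !(mulrA (a^-1)%:MP%:P) a1 mul1r.
- rewrite mevalZ -[p.@[_]]/(peval p y) -qp nmulr_llt0 // invr_gt0.
  by have := qv; rewrite qp.
- move=> x; rewrite mevalZ => /eqP; rewrite mulf_eq0 invr_eq0 (negPf a0) /=.
  (* [r_vanish] speaks of row vectors and [dvd_of_vanish] of functions; the rebuilt row agrees with
     [x] pointwise, which is enough for [meval]. *)
  have xE : (\row_i x i) 0 =1 x by move=> i; rewrite mxE.
  have := r_vanish (\row_i x i); rewrite qp /peval !(meval_eq _ xE) => + /eqP.
  by apply.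
by exists p, (a^-1 *: s); split=> //; rewrite rs -scalerAl -scalerAr.
Qed.
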